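(* Let $N\ge1$ and, for each $k\in\{1,\ldots,N\}$, let $\{\varphi_{n,k}\}_{n\ge0}$ be a family of orthonormal polynomials on the real line, with $\varphi_{0,k}=1$, determined by the recursion $$x\varphi_{n,k}(x)=a_{n+1,k}\varphi_{n+1,k}(x)+b_{n,k}\varphi_{n,k}(x)+a_{n,k}\varphi_{n-1,k}(x),\qquad n\ge0,$$ where $\varphi_{-1,k}=0$, $a_{n,k}>0$ for $n\ge1$, and $b_{n,k}\in\mathbb R$ for $n\ge0$. Put $\varphi_\emptyset=1$ and, for a nonempty word $\sigma\in\mathbb F_N^+$ written uniquely as $\sigma=i_1^{k_1}\cdots i_p^{k_p}$ with $i_1,\ldots,i_p\in\{1,\ldots,N\}$, $k_1,\ldots,k_p>0$ and $i_l\ne i_{l+1}$ for $l=1,\ldots,p-1$, define the polynomial in the non-commuting variables $X_1,\ldots,X_N$ $$\varphi_\sigma(X_1,\ldots,X_N)=\varphi_{k_1,i_1}(X_{i_1})\cdots\varphi_{k_p,i_p}(X_{i_p}).$$ Let $\Phi_n=[\varphi_\sigma]_{|\sigma|=n}$ for $n\ge0$ and $\Phi_{-1}=0$. Then there exists an admissible family $\mathcal A=\{A_{n,k},B_{m,k}\mid n>0,\ m\ge0,\ k=1,\ldots,N\}$ of matrices such that for $k=1,\ldots,N$ and $n\ge0$, $$X_k\Phi_n=\Phi_{n+1}A_{n+1,k}+\Phi_nB_{n,k}+\Phi_{n-1}A_{n,k}^*.$$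
   Context: $\mathbb F_N^+$ is the free unital semigroup (words) on the letters $1,\ldots,N$, with identity the empty word $\emptyset$; $|\sigma|$ is the length of $\sigma$. Polynomials are elements of $\mathcal P_N$, the algebra of complex polynomials in $N$ non-commuting indeterminates $X_1,\ldots,X_N$. $\Phi_n$ is the row vector of length $N^n$ with entries $\varphi_\sigma$, $|\sigma|=n$, listed in lexicographic order of the words $\sigma$; the term with $\Phi_{-1}$ in the three-term relation (for $n=0$) is $0$. A family of complex matrices $\{A_{n,k},B_{m,k}\mid n>0,\ m\ge0,\ k=1,\ldots,N\}$ is called *admissible* if each $B_{m,k}$ is a selfadjoint $N^m\times N^m$ matrix, each $A_{n,k}$ is an $N^n\times N^{n-1}$ matrix, and for every $n\ge1$ the $N^n\times N^n$ matrix $A_n=[A_{n,1}\ \cdots\ A_{n,N}]$ is upper triangular and invertible with strictly positive diagonal entries. *)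

(* Defs.v *)
From HB Require Import structures.
From mathcomp Require Import all_boot all_order all_algebra complex.
From mathcomp.multinomials Require Import monalg.
From mathcomp Require Import all_classical all_reals all_analysis.

Set Implicit Arguments.
Unset Strict Implicit.
Unset Printing Implicit Defensive.

Import Order.TTheory GRing.Theory Num.Theory.
Local Open Scope ring_scope.
Local Open Scope complex_scope.
Local Open Scope sesquilinear_scope.

Section Runs.
Variable T : eqType.
Implicit Types (s : seq T) (r : seq (T * nat)).

(* [runs s] is the list of pairs (i_l, k_l) such that s = i_1^k_1 ... i_p^k_p
   with k_l > 0 and i_l <> i_(l+1); existence and uniqueness of this
   factorization are proved in [runsK], [runs_reduced] and [expandK]. *)
Fixpoint runs s : seq (T * nat) :=
  if s is x :: s' then
    if runs s' is (y, k) :: r then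
      if x == y then (y, k.+1) :: r else (x, 1%N) :: (y, k) :: r
    else [:: (x, 1%N)]
  else [::].

Definition expand r : seq T := flatten [seq nseq b.2 b.1 | b <- r].

Definition reduced r : bool :=
  all (fun b => (0 < b.2)%N) r && sorted (fun b c => b.1 != c.1) r.

Lemma runsK s : expand (runs s) = s.
Proof.
elim: s => //= x s; case: (runs s) => [<-|[y k] r] //=.
by case: eqP => [->|_] <-.
Qed.

Lemma runs_reduced s : reduced (runs s).
Proof.
elim: s => //= x s; case: (runs s) => [|[y k] r] //=.
rewrite /reduced /= => /andP[/andP[k0 r0] p].
case: (eqVneq x y) => [_|xy] /=; rewrite r0 ?k0 /= ?xy //.
by case: r p {r0}.
Qed.

Lemma expandK r : reduced r -> runs (expand r) = r.
Proof.
elim: r => //= -[x k] r IH /andP[/= /andP[k0 r0] p].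
have rr : reduced r by rewrite /reduced r0 (path_sorted p).
rewrite /expand /= -/(expand r); case: k k0 p => // k _ p.
have {}p : if r is (y, _) :: _ then x != y else true.
  by case: r p {IH r0 rr} => [|[y m] r] //= /andP[].
elim: k => [|k /= ->]; last by rewrite eqxx.
rewrite /= (IH rr); case: r p {IH r0 rr} => [|[y m] r] //=.
by move=> /negbTE ->.
Qed.

End Runs.

Section OrthonormalPolynomials.
Variable R : realType.

(* Sequences of orthonormal polynomials with respect to some Borel measure on
   the real line (integrability of all products makes all moments finite). *)
Definition orthonormal_polynomials (p : nat -> {poly R}) : Prop :=
  (forall n, size (p n) = n.+1) /\
  exists mu : {measure set (measurableTypeR R) -> \bar R}, forall m n : nat,
    mu.-integrable [set: R] (fun x => ((p m).[x] * (p n).[x])%:E) /\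
    (\int[mu]_(x in [set: R]) ((p m).[x] * (p n).[x])%:E)%E = (m == n)%:R%:E.

Definition three_term_recursion (p : nat -> {poly R}) (a b : nat -> R) : Prop :=
  forall n, 'X * p n =
    a n.+1 *: p n.+1 + b n *: p n + a n *: (if n is m.+1 then p m else 0).

End OrthonormalPolynomials.

Section NonCommutativePolynomials.
Variables (R : realType) (N : nat).

(* The monoid algebra over the complex numbers of the free monoid on N letters *)
Local Notation ncpoly := {malg R[i][{fmonom 'I_N}]}.

Definition ncX (k : 'I_N) : ncpoly :=
  << fmu k >>.

Definition nc_eval (p : {poly R}) (k : 'I_N) : ncpoly :=
  (map_poly (fun c : R => c%:C%:A) p).[ncX k].

Definition phi_word (phi : nat -> 'I_N -> {poly R}) (s : seq 'I_N) : ncpoly :=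
  \prod_(b <- runs s) nc_eval (phi b.2 b.1) b.1.

Lemma card_words n : (N ^ n = #|{: n.-tuplelexi 'I_N}|)%N.
Proof. by rewrite card_tuple card_ord. Qed.

(* The words of length n in increasing lexicographic order *)
Definition lexword n (j : 'I_(N ^ n)) : n.-tuplelexi 'I_N :=
  Order.enum_val (cast_ord (card_words n) j).

Lemma le_lexword n (i j : 'I_(N ^ n)) :
  (lexword i <= lexword j)%O = (i <= j)%N.
Proof.
by rewrite /lexword (Order.le_enum_val (@le_total _ (n.-tuplelexi 'I_N))).
Qed.

Definition Phi (phi : nat -> 'I_N -> {poly R}) n : 'rV[ncpoly]_(N ^ n) :=
  \row_j phi_word phi (lexword j).

(* Phi_(n-1); its width for n = 0 is irrelevant since it is 0 there *)
Definition Phi_pred (phi : nat -> 'I_N -> {poly R}) n :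
    'rV[ncpoly]_(N ^ n.-1) :=
  if n is m.+1 then Phi phi m else 0.

Definition nc_mx m n (M : 'M[R[i]]_(m, n)) : 'M[ncpoly]_(m, n) :=
  map_mx (fun c : R[i] => c%:A) M.

Lemma sum_expn n : (\sum_(k < N) N ^ n.+1.-1 = N ^ n.+1)%N.
Proof. by rewrite sum_nat_const card_ord -expnS. Qed.

(* The square matrix A_(n+1) = [A_(n+1,1) ... A_(n+1,N)] *)
Definition concat_mx n (A : 'I_N -> 'M[R[i]]_(N ^ n.+1, N ^ n.+1.-1)) :
    'M[R[i]]_(N ^ n.+1) :=
  castmx (erefl, sum_expn n) (\mxrow_(k < N) A k).

(* [A 0] is a dummy, on which no condition is imposed; [is_trig_mx] means lower
   triangular, hence the transpose. *)
Definition admissible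
    (A : forall n, 'I_N -> 'M[R[i]]_(N ^ n, N ^ n.-1))
    (B : forall m, 'I_N -> 'M[R[i]]_(N ^ m)) : Prop :=
  (forall m k, (B m k)^t* = B m k) /\
  (forall n, let An := concat_mx (A n.+1) in
    [/\ is_trig_mx An^T, An \in unitmx & forall i, 0 < An i i]).

End NonCommutativePolynomials.

(* Main.v *)
Require Import Defs.
From mathcomp Require Import all_boot all_order all_algebra complex.
From mathcomp.multinomials Require Import monalg.
From mathcomp Require Import all_classical all_reals all_analysis.

Set Implicit Arguments.
Unset Strict Implicit.
Unset Printing Implicit Defensive.

Import Order.TTheory GRing.Theory Num.Theory.
Local Open Scope ring_scope.
Local Open Scope complex_scope.
Local Open Scope sesquilinear_scope.

(** Left multiplication by X_k only touches the block of letters k at the start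
of a word. If s = k^r t, where t does not start with k and r may be 0, then
phi_s = phi_(r,k)(X_k) phi_t, because phi_(0,k) = 1. The scalar recursion for
phi_(r,k) therefore gives
    X_k phi_s = a_(r+1,k) phi_(ks) + b_(r,k) phi_s + a_(r,k) phi_(s'),
where s = ks' if r > 0, and where the last term is absent if r = 0
([ncX_phi_word]).

Reading off coefficients, B_(n,k) is diagonal and A_(n+1,k) has in the column
of s a single nonzero entry a_(r+1,k), in the row of ks. The third term comes
out as the adjoint of A_(n,k) because its coefficient a_(r,k) is also the entry
of A_(n,k) in column s' and row s = ks' ([Phi_rec]).

The blocks A_(n+1,1), ..., A_(n+1,N) list their columns in the order of the
words ks, first by k and then by s, and this is the lexicographic order on
words of length n+1 ([lexword_cons]). So the concatenated matrix is diagonal,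
with the positive numbers a_(r+1,k) on its diagonal ([concat_jacobiA]),
hence upper triangular and invertible. *)

Definition leading_run (T : eqType) (k : T) (s : seq T) : nat :=
  find (predC1 k) s.
Arguments leading_run : simpl never.

Lemma leading_run_cons (T : eqType) (k : T) s :
  leading_run k (k :: s) = (leading_run k s).+1.
Proof. by rewrite /leading_run /= eqxx. Qed.

Lemma leading_run_neq (T : eqType) (k x : T) s :
  x != k -> leading_run k (x :: s) = 0%N.
Proof. by rewrite /leading_run /= => ->. Qed.

(** This gives the factorization of a word from its first letter on; the
recursion in the definition of [runs] instead inspects the factorization of the
tail. *)
Lemma runs_cons (T : eqType) (k : T) s :
  runs (k :: s) = (k, (leading_run k s).+1) :: runs (drop (leading_run k s) s).
Proof.
elim: s k => // x s IH k; have [<-|xk] := eqVneq x k.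
  by rewrite leading_run_cons /=; have /= -> := IH x; rewrite eqxx.
rewrite leading_run_neq // drop0 /=; have /= -> := IH x.
by rewrite eq_sym (negbTE xk).
Qed.

Section Words.
Variable N : nat.

Lemma lexword_bij n : bijective (@lexword N n).
Proof.
apply: bij_comp; first exact: Order.EnumVal.enum_val_bij.
exists (cast_ord (esym (card_words N n))); first exact: cast_ordK.
exact: cast_ordKV.
Qed.

(** Evaluates a matrix product over word-indexed rows in which a column has its
only nonzero entry in the row of a prescribed word. *)
Lemma sum_lexword (V : nmodType) n (F : seq 'I_N -> V) (s : seq 'I_N) :
  size s = n ->
  \sum_(i < N ^ n) (if lexword i == s :> seq 'I_N then F (lexword i) else 0)
    = F s.
Proof.
move=> sz; have [g gK Kg] := lexword_bij n.
pose t : n.-tuplelexi 'I_N := Tuple (introT eqP sz).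
have lt : lexword (g t) = s :> seq _ by rewrite Kg.
rewrite (bigD1 (g t)) //= lt eqxx big1 ?addr0 // => i /eqP ne.
case: eqP => // E; case: ne; apply: (can_inj gK); apply: val_inj.
exact: etrans E (esym lt).
Qed.

(** Concatenating N blocks of N^n columns numbers the pairs (letter, word of
length n) lexicographically, letter first. The resulting enumeration of words of
length n+1 is increasing, so it agrees with [lexword], an increasing bijection
between finite total orders being unique. *)
Lemma lexword_cons n (c : 'I_(N ^ n.+1)) :
  let c' := cast_ord (esym (sum_expn N n)) c in
  lexword c = tagnat.sig1 c' :: lexword (tagnat.sig2 c') :> seq 'I_N.
Proof.
move=> c'; rewrite {}/c'.
pose f (c : 'I_(N ^ n.+1)) : n.+1.-tuplelexi 'I_N :=
  let c' := cast_ord (esym (sum_expn N n)) c in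
  [tuple of tagnat.sig1 c' :: lexword (tagnat.sig2 c')].
have f_mono : {mono f : c d / (c <= d)%O}.
  move=> d e; pose cast := cast_ord (esym (sum_expn N n)).
  rewrite -[RHS]/(cast d <= cast e)%O.
  rewrite -tagnat.le_sig leEsig /=.
  rewrite [LHS]lexi_cons.
  rewrite /tagnat.sig2 /tagnat.sig1 [X in _ && (_ ==> X)]le_lexword.
  move: (tagnat.sig _) (tagnat.sig _) => [x i] [y j] /=.
  by case: (ltgtP x y) => //= xy; case: y / xy j => j; rewrite tagged_asE.
(* Uniqueness needs source and target to carry the same order display, hence the
   detour through g \o f, an increasing self-map of the indices. *)
have [g gK Kg] := lexword_bij n.+1.
have g_mono : {mono (g \o f) : c d / (c <= d)%O}.
  move=> d e /=.
  by rewrite -[LHS]/(g (f d) <= g (f e))%N -le_lexword !Kg f_mono.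
have id_mono : {mono @id 'I_(N ^ n.+1) : x y / (x <= y)%O} by move=> x y.
have gf : g (f c) = c.
  exact: (Order.mono_unique (@le_total _ _) (leqnn _) g_mono id_mono).
by rewrite -[in LHS]gf Kg.
Qed.

End Words.

Section ThreeTerm.
Variables (R : realType) (N : nat).
Local Notation ncpoly := {malg R[i][{fmonom 'I_N}]}.

(** Scalars are central although the words do not commute: a scalar is supported
on the empty word, which is neutral on both sides. *)
Lemma mulr_malg_scalar (x : ncpoly) (c : R[i]) : x * c%:A = c *: x.
Proof.
rewrite -!mul_malgC mulr1 !malgM_def fgmulUg fgmulgU.
by apply: eq_bigr => m _; rewrite mulrC mulm1 mul1m.
Qed.

Lemma conjC_real_complex (x : R) : (x%:C : R[i])^*%R = x%:C.
Proof. exact: conjc_real. Qed.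

Implicit Types (p q : {poly R}) (k : 'I_N).
(** Composing two canonical morphisms makes the coefficient map of [nc_eval]
visible as a ring morphism, so that the lemmas on [map_poly] apply. *)
Let coef : {rmorphism R -> ncpoly} := (in_alg ncpoly \o real_complex R).

Lemma nc_evalE p k : nc_eval p k = (map_poly coef p).[ncX R k].
Proof. by []. Qed.

Lemma nc_eval1 k : nc_eval 1 k = 1 :> ncpoly.
Proof. by rewrite nc_evalE rmorph1 hornerC. Qed.

Lemma nc_evalD p q k : nc_eval (p + q) k = nc_eval p k + nc_eval q k.
Proof. by rewrite !nc_evalE rmorphD hornerD. Qed.

Lemma nc_evalZ (c : R) p k : nc_eval (c *: p) k = c%:C *: nc_eval p k.
Proof. by rewrite !nc_evalE map_polyZ hornerZ mulr_algl. Qed.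

Lemma nc_eval0 k : nc_eval 0 k = 0 :> ncpoly.
Proof. by rewrite nc_evalE rmorph0 horner0. Qed.

(** Polynomial evaluation in a non-commutative ring puts the variable to the
right of the coefficients; centrality of the scalars lets it move to the left,
where the three-term relation has it. *)
Lemma nc_evalMX p k : nc_eval ('X * p) k = ncX R k * nc_eval p k.
Proof.
rewrite -commr_polyX !nc_evalE rmorphM /= map_polyX hornerMX.
apply: esym; apply: (@commr_horner ncpoly); first by [].
by move=> i; rewrite coef_map /= /GRing.comm mulr_algl mulr_malg_scalar.
Qed.

Variables (phi : nat -> 'I_N -> {poly R}) (a b : nat -> 'I_N -> R).
Hypothesis phi0 : forall k, phi 0%N k = 1.
Hypothesis phi_rec : forall k, three_term_recursion (phi^~ k) (a^~ k) (b^~ k).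

Lemma phi_word_cons k s : let r := leading_run k s in
  phi_word phi (k :: s) = nc_eval (phi r.+1 k) k * phi_word phi (drop r s).
Proof. by rewrite /phi_word runs_cons big_cons. Qed.

(** Compared with [phi_word_cons], this also covers words that do not start
with k: their leading run is 0, and phi_(0,k) = 1. It puts all the words in
[ncX_phi_word] over the same right factor. *)
Lemma phi_word_split k s : let r := leading_run k s in
  phi_word phi s = nc_eval (phi r k) k * phi_word phi (drop r s).
Proof.
case: s => [|x s]; first by rewrite /= phi0 nc_eval1 mul1r.
have [->|xk] := eqVneq x k; first by rewrite leading_run_cons /= phi_word_cons.
by rewrite leading_run_neq //= phi0 nc_eval1 mul1r.
Qed.

(** The three-term relation, word by word: it is the scalar recursion at index
r multiplied on the right by the part of the word after its leading run. *)
Lemma ncX_phi_word k s : let r := leading_run k s in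
  ncX R k * phi_word phi s =
    (a r.+1 k)%:C *: phi_word phi (k :: s) + (b r k)%:C *: phi_word phi s
    + (if s is x :: s' then
         if x == k then (a r k)%:C *: phi_word phi s' else 0
       else 0).
Proof.
move=> r; rewrite phi_word_cons -/r {1 2}(phi_word_split k s) -/r.
rewrite !scalerAl mulrA -nc_evalMX phi_rec !nc_evalD !nc_evalZ !mulrDl.
congr (_ + _); rewrite /r.
case: s {r} => [|x s]; first by rewrite nc_eval0 scaler0 mul0r.
have [->|xk] := eqVneq x k.
  by rewrite leading_run_cons /= (phi_word_split k s) scalerAl.
by rewrite leading_run_neq // nc_eval0 scaler0 mul0r.
Qed.

(** The leading run is counted in the longer word, the one of row i, so that it
is r+1 when the word of column j starts with exactly r letters k. *)
Definition jacobiA n k : 'M[R[i]]_(N ^ n, N ^ n.-1) :=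
  \matrix_(i, j) if lexword i == k :: lexword j :> seq 'I_N
                 then (a (leading_run k (lexword i)) k)%:C else 0.

Definition jacobiB n k : 'M[R[i]]_(N ^ n) :=
  \matrix_(i, j) if lexword i == lexword j :> seq 'I_N
                 then (b (leading_run k (lexword i)) k)%:C else 0.

Lemma Phi_rec k n :
  ncX R k *: Phi phi n =
    Phi phi n.+1 *m nc_mx N (jacobiA n.+1 k)
    + Phi phi n *m nc_mx N (jacobiB n k)
    + Phi_pred phi n *m nc_mx N ((jacobiA n k)^t*).
Proof.
apply/rowP => j; rewrite !mxE ncX_phi_word; congr (_ + _ + _).
- pose F s := (a (leading_run k s) k)%:C *: phi_word phi s.
  rewrite -leading_run_cons -/(F (k :: lexword j)) -(sum_lexword (n := n.+1)).
    apply: eq_bigr => i _; rewrite !mxE mulr_malg_scalar.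
    by case: ifP; rewrite ?scale0r.
  by rewrite /= size_tuple.
- pose F s := (b (leading_run k s) k)%:C *: phi_word phi s.
  rewrite -/(F (lexword j)) -(sum_lexword (n := n)); last by rewrite size_tuple.
  apply: eq_bigr => i _; rewrite !mxE mulr_malg_scalar.
  by case: ifP; rewrite ?scale0r.
case: n j => [|n] j.
  rewrite big1 => [|i _]; last by rewrite mxE mul0r.
  by case: (lexword j) => -[].
have := size_tuple (lexword j); case E : (tval (lexword j)) => [|x s] //= [sz].
under eq_bigr => i _ do rewrite !mxE mulr_malg_scalar E eqseq_cons.
case: eqVneq => [->|_]; last first.
  by rewrite big1 // => i _; rewrite /= conjC0 scale0r.
(* The coefficient in F is that of the word ks whatever t is, since
   transposition made ks the row index of jacobiA; only t = s contributes. *)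
pose F t := (a (leading_run k (k :: s)) k)%:C *: phi_word phi t.
transitivity (F s); first by rewrite /F leading_run_cons.
rewrite -(sum_lexword F sz); apply: eq_bigr => i _; rewrite andTb eq_sym.
case: ifP => _; last by rewrite conjC0 scale0r.
by rewrite conjC_real_complex.
Qed.

(** Column j of the concatenation has its only nonzero entry in the row of the
word obtained by prefixing the letter of its block, and by [lexword_cons] that
row has the same index j. *)
Lemma concat_jacobiA n i j :
  let c := cast_ord (esym (sum_expn N n)) j in
  let k := tagnat.sig1 c in
  concat_mx (jacobiA n.+1) i j =
    if i == j
    then (a (leading_run k (lexword (tagnat.sig2 c))).+1 k)%:C else 0.
Proof.
move=> c k; rewrite castmxE !mxE cast_ord_id -/c -lexword_cons.
have [g gK _] := lexword_bij N n.+1.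
rewrite val_eqE (can_eq gK); case: eqP => // ->.
by rewrite lexword_cons leading_run_cons.
Qed.

Lemma jacobi_admissible : (forall n k, (1 <= n)%N -> 0 < a n k) ->
  admissible jacobiA jacobiB.
Proof.
move=> a_gt0; split=> [m k|n An].
  apply/matrixP => i j; rewrite !mxE eq_sym; case: eqP => [->|_].
    by rewrite conjC_real_complex.
  by rewrite conjC0.
have An_gt0 i : 0 < An i i by rewrite concat_jacobiA eqxx ltcR a_gt0.
have An_trig : is_trig_mx An^T.
  apply/is_trig_mxP => i j ij; rewrite mxE concat_jacobiA.
  by case: eqP ij => // ->; rewrite ltnn.
split=> //; rewrite unitmxE unitfE -det_tr det_trig //.
by apply/prodf_neq0 => i _; rewrite mxE lt0r_neq0.
Qed.

End ThreeTerm.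

Theorem theorem3p1 (R : realType) (N : nat) (hN : (1 <= N)%N)
    (phi : nat -> 'I_N -> {poly R}) (a b : nat -> 'I_N -> R)
    (phi_orth : forall k, orthonormal_polynomials (phi^~ k))
    (phi0 : forall k, phi 0%N k = 1)
    (a_gt0 : forall n k, (1 <= n)%N -> 0 < a n k)
    (phi_rec : forall k, three_term_recursion (phi^~ k) (a^~ k) (b^~ k)) :
  exists (A : forall n, 'I_N -> 'M[R[i]]_(N ^ n, N ^ n.-1))
         (B : forall m, 'I_N -> 'M[R[i]]_(N ^ m)),
    admissible A B /\
    forall (k : 'I_N) (n : nat),
      ncX R k *: Phi phi n =
        Phi phi n.+1 *m nc_mx N (A n.+1 k) + Phi phi n *m nc_mx N (B n k)
        + Phi_pred phi n *m nc_mx N ((A n k)^t*).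
Proof.
exists (jacobiA a), (jacobiB b); split; first exact: jacobi_admissible.
by move=> k n; apply: Phi_rec.
Qed.
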